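(* Let $m,n\geq 4$ be integers with $m+n\geq 9$. Then the chromatic polynomial of the interlocking wheel $W_m\wedge_2 W_n$ is $$\chi(W_m\wedge_2 W_n,t)=\frac{1}{t-1}\Big[t(t-2)(t-3)\big((t-2)^{n-3}+(-1)^n\big)\big((t-2)^{m-3}+(-1)^m\big)+t(t-2)^3\big((t-2)^{n-4}+(-1)^{n-1}\big)\big((t-2)^{m-4}+(-1)^{m-1}\big)\Big].$$
   Context: All graphs are finite, simple and undirected. For a graph $G$, $\chi(G,t)$ denotes its chromatic polynomial, i.e. the polynomial in $t$ over $\mathbb{Z}$ whose value at each nonnegative integer $t$ is the number of proper colorings $f:V(G)\to C$, where $C$ is a fixed set of $t$ colors and proper means $f(u)\neq f(v)$ whenever $\{u,v\}$ is an edge. For $n\geq 4$, the wheel $W_n$ is the graph on $n$ vertices consisting of a cycle $C_{n-1}$ (the rim) on $n-1$ vertices together with one further vertex (the hub) adjacent to all vertices of the rim. The double wedge $\wedge_2$ is the graph on four vertices $u,v,a,b$ with the five edges $\{u,v\},\{u,a\},\{u,b\},\{v,a\},\{v,b\}$ (two triangles sharing the edge $\{u,v\}$). The interlocking wheel $W_m\wedge_2 W_n$ is the overlap of $W_m$ and $W_n$ in $\wedge_2$, obtained as follows: in $W_m$ let $u$ be the hub and let $a,v,b$ be three consecutive rim vertices (so $v$ is adjacent on the rim to $a$ and $b$); in $W_n$ let $v$ be the hub and let $a,u,b$ be three consecutive rim vertices (so $u$ is adjacent on the rim to $a$ and $b$). Identify the two copies of each of $u,v,a,b$, and hence the two copies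 of $\wedge_2$; there are no other identifications of vertices, and multiple edges are merged into single edges. Thus $W_m\wedge_2 W_n$ has $m+n-4$ vertices: the four vertices $u,v,a,b$, together with the $m-4$ remaining rim vertices of $W_m$ and the $n-4$ remaining rim vertices of $W_n$. *)

(* Defs.v *)
From HB Require Import structures.
From mathcomp Require Import all_boot all_order all_algebra.

Set Implicit Arguments.
Unset Strict Implicit.
Unset Printing Implicit Defensive.

Import GRing.Theory.
Local Open Scope ring_scope.

Record sgraph := SGraph {
  vertex :> finType;
  edge : rel vertex;
  edge_sym : symmetric edge;
  edge_irr : irreflexive edge
}.

Definition proper_coloring (G : sgraph) (k : nat) (f : {ffun G -> 'I_k}) : bool :=
  [forall x, forall y, edge x y ==> (f x != f y)].

Definition num_colorings (G : sgraph) (k : nat) : nat :=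
  #|[set f : {ffun G -> 'I_k} | proper_coloring f]|.

(* Deletion-contraction along a list of pairs of vertices. *)
Lemma coloring_poly_seq (T : finType) (s : seq (T * T)) :
  {p : {poly int} | forall k : nat,
     p.[k%:R] = #|[set f : {ffun T -> 'I_k} |
                     all (fun e => f e.1 != f e.2) s]|%:R}.
Proof.
have [n] := ubnP (size s); elim: n T s => // n IHn T [_|[x y] s].
  exists 'X^#|T| => k; rewrite hornerXn -natrX; congr (_%:R).
  by rewrite -[k in LHS]card_ord -card_ffun; apply: eq_card => f; rewrite !inE.
rewrite ltnS /= => szs.
have [p pP] := IHn _ s szs.
have [<-|nxy] := eqVneq x y.
  exists 0 => k; rewrite horner0 eq_card0 // => f.
  by rewrite !inE eqxx.
pose T' : finType := {z : T | z != y}.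
pose h (z : T) : T' := insubd (exist _ x nxy : T') z.
have hval z' : h (val z') = z' by rewrite /h valKd.
have hy : val (h y) = x by rewrite /h val_insubd eqxx.
have valh z : z != y -> val (h z) = z by move=> zy; rewrite /h insubdK.
have [|q qP] := IHn T' [seq (h e.1, h e.2) | e <- s]; first by rewrite size_map.
exists (p - q) => k; rewrite hornerD hornerN {}pP {}qP.
apply/eqP; rewrite subr_eq -natrD; apply/eqP; congr (_%:R).
pose A := [set f : {ffun T -> 'I_k} | f x == f y].
rewrite -(cardsID A) addnC; congr (_ + _)%N.
  by apply: eq_card => f; rewrite !inE; case: (_ == _).
pose F (g : {ffun T' -> 'I_k}) := [ffun z : T => g (h z)].
have Finj : injective F.
  move=> g1 g2 /ffunP eqF; apply/ffunP=> z.
  by have := eqF (val z); rewrite !ffunE hval.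
rewrite -(card_imset _ Finj); apply: eq_card => f; rewrite !inE.
apply/andP/imsetP=> [[sf /eqP fxy]|[g]].
  have fh z : f (val (h z)) = f z.
    by have [->|/valh->//] := eqVneq z y; rewrite hy.
  exists [ffun z => f (val z)]; last by apply/ffunP=> z; rewrite !ffunE fh.
  rewrite inE all_map; apply: etrans sf; apply: eq_all => e /=.
  by rewrite !ffunE !fh.
rewrite inE all_map => sg ->; split; last first.
  by rewrite !ffunE -{1}hy hval.
by apply: etrans sg; apply: eq_all => e /=; rewrite !ffunE.
Qed.

Lemma chromatic_poly_sig (G : sgraph) :
  {p : {poly int} | forall k : nat, p.[k%:R] = (num_colorings G k)%:R}.
Proof.
have [p pP] := coloring_poly_seq [seq e <- enum {: G * G} | edge e.1 e.2].
exists p => k; rewrite {}pP; congr (_%:R); apply: eq_card => f; rewrite !inE.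
apply/allP/forallP=> [fP x|fP [x y]].
  apply/forallP=> y; apply/implyP=> xy.
  by apply: (fP (x, y)); rewrite mem_filter mem_enum andbT.
rewrite mem_filter /= => /andP[xy _].
by have /forallP/(_ y)/implyP := fP x; apply.
Qed.

Definition chromatic_poly (G : sgraph) : {poly int} :=
  sval (chromatic_poly_sig G).

Lemma chromatic_polyE (G : sgraph) (k : nat) :
  (chromatic_poly G).[k%:R] = (num_colorings G k)%:R.
Proof. exact: svalP (chromatic_poly_sig G) k. Qed.

Lemma chromatic_poly_uniq (G : sgraph) (p : {poly int}) :
  (forall k : nat, p.[k%:R] = (num_colorings G k)%:R) -> p = chromatic_poly G.
Proof.
move=> pP; apply/eqP; rewrite -subr_eq0; apply/negP=> /negP nz.
pose rs := [seq Posz k | k <- iota 0 (size (p - chromatic_poly G))].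
suff: (size rs < size (p - chromatic_poly G)%R)%N.
  by rewrite size_map size_iota ltnn.
apply: max_poly_roots => //; last by rewrite map_inj_uniq ?iota_uniq // => i j [].
apply/allP=> _ /mapP[k _ ->]; rewrite /root hornerD hornerN -(natz k).
by rewrite pP chromatic_polyE subrr.
Qed.

(* The rim is 'Z_(n.-1), which has n.-1 elements as soon as 3 <= n; None is   *)
(* the hub.                                                                   *)
Definition wheel_edge (n : nat) : rel (option 'Z_(n.-1)) := fun x y =>
  match x, y with
  | Some i, Some j => (j == i + 1) || (i == j + 1)
  | None, None => false
  | _, _ => true
  end.

Lemma wheel_edge_sym n : symmetric (@wheel_edge n).
Proof. by case=> [i|] [j|] //=; rewrite orbC. Qed.

Lemma wheel_edge_irr n : irreflexive (@wheel_edge n).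
Proof.
by case=> [i|] //=; rewrite orbb -subr_eq0 opprD addNKr oppr_eq0 oner_eq0.
Qed.

Definition wheel (n : nat) : sgraph :=
  SGraph (@wheel_edge_sym n) (@wheel_edge_irr n).

Definition hub (n : nat) : wheel n := None.
Definition rim (n : nat) (i : 'Z_(n.-1)) : wheel n := Some i.

(* Overlap of G and H in K, along f : K -> G and g : K -> H (meant to be      *)
(* injective graph homomorphisms): the disjoint union of G and H with f k and *)
(* g k identified for all k, and parallel edges merged. Every identified      *)
(* vertex is represented by its copy in G, so that the edges of H between     *)
(* identified vertices are transported along f. The guard x != x' is vacuous  *)
(* when f is injective; it makes the construction total.                      *)
Section Overlap.
Variables (K G H : sgraph) (f : K -> G) (g : K -> H).

Definition overlap_vertex : finType := (G + {y : H | y \notin codom g})%type.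

Definition overlap_edge : rel overlap_vertex := fun p q =>
  match p, q with
  | inl x, inl x' => edge x x' || (x != x') &&
      [exists k, exists k', [&& f k == x, f k' == x' & edge (g k) (g k')]]
  | inl x, inr y | inr y, inl x => [exists k, (f k == x) && edge (g k) (val y)]
  | inr y, inr y' => edge (val y) (val y')
  end.

Lemma overlap_edge_sym : symmetric overlap_edge.
Proof.
case=> [x|y] [x'|y'] //=; last exact: edge_sym.
rewrite edge_sym [in RHS]eq_sym; congr (_ || _ && _).
by apply/existsP/existsP => -[k /existsP[k' /and3P[? ? ?]]]; exists k';
  apply/existsP; exists k; rewrite edge_sym; apply/and3P.
Qed.

Lemma overlap_edge_irr : irreflexive overlap_edge.
Proof. by case=> [x|y] /=; rewrite edge_irr ?eqxx. Qed.

Definition overlap : sgraph := SGraph overlap_edge_sym overlap_edge_irr.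

End Overlap.

Inductive wedge_vertex := wu | wv | wa | wb.

Definition wedge_vertex_code (x : wedge_vertex) : bool * bool :=
  match x with
  | wu => (false, false) | wv => (false, true)
  | wa => (true, false) | wb => (true, true)
  end.
Definition wedge_vertex_decode (i : bool * bool) : wedge_vertex :=
  match i with
  | (false, false) => wu | (false, true) => wv
  | (true, false) => wa | (true, true) => wb
  end.
Lemma wedge_vertex_codeK : cancel wedge_vertex_code wedge_vertex_decode.
Proof. by case. Qed.

HB.instance Definition _ :=
  Countable.copy wedge_vertex (can_type wedge_vertex_codeK).
HB.instance Definition _ :=
  Finite.copy wedge_vertex (can_type wedge_vertex_codeK).

(* All pairs of distinct vertices except {wa, wb}. *)
Definition double_wedge_edge : rel wedge_vertex := fun x y =>
  (x != y) && ((x \in [:: wu; wv]) || (y \in [:: wu; wv])).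

Lemma double_wedge_edge_sym : symmetric double_wedge_edge.
Proof. by move=> x y; rewrite /double_wedge_edge eq_sym orbC. Qed.

Lemma double_wedge_edge_irr : irreflexive double_wedge_edge.
Proof. by move=> x; rewrite /double_wedge_edge eqxx. Qed.

Definition double_wedge : sgraph :=
  SGraph double_wedge_edge_sym double_wedge_edge_irr.

(* The three consecutive rim vertices are -1, 0 and 1. *)
Definition wedge_hub_u (m : nat) (x : double_wedge) : wheel m :=
  match x with
  | wu => hub m | wa => rim (-1) | wv => rim 0 | wb => rim 1
  end.

Definition wedge_hub_v (n : nat) (x : double_wedge) : wheel n :=
  match x with
  | wv => hub n | wa => rim (-1) | wu => rim 0 | wb => rim 1
  end.

Definition interlocking_wheel (m n : nat) : sgraph :=
  overlap (@wedge_hub_u m) (@wedge_hub_v n).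

Lemma wedge_rim_neq (n : nat) :
  (4 <= n)%N -> [/\ -1 != 0 :> 'Z_(n.-1), -1 != 1 :> 'Z_(n.-1)
                   & 0 != 1 :> 'Z_(n.-1)].
Proof.
case: n => [|[|[|[|n]]]] // _; split=> //; first by rewrite oppr_eq0 oner_eq0.
by rewrite eq_sym -addr_eq0.
Qed.

Lemma wedge_hub_u_inj (m : nat) : (4 <= m)%N -> injective (@wedge_hub_u m).
Proof.
move=> /wedge_rim_neq[/eqP n1 /eqP n2 /eqP n3].
move=> [] [] // /Some_inj;
  by [move/n1 | move/n2 | move/n3 | move/esym/n1 | move/esym/n2 | move/esym/n3].
Qed.

Lemma wedge_hub_v_inj (n : nat) : (4 <= n)%N -> injective (@wedge_hub_v n).
Proof.
move=> /wedge_rim_neq[/eqP n1 /eqP n2 /eqP n3].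
move=> [] [] // /Some_inj;
  by [move/n1 | move/n2 | move/n3 | move/esym/n1 | move/esym/n2 | move/esym/n3].
Qed.

Lemma wedge_hub_u_edge (m : nat) (x y : double_wedge) :
  edge x y -> edge (wedge_hub_u m x) (wedge_hub_u m y).
Proof.
by move: x y => [] [] //= _; rewrite ?addNr ?add0r ?eqxx ?orbT. 
Qed.

Lemma wedge_hub_v_edge (n : nat) (x y : double_wedge) :
  edge x y -> edge (wedge_hub_v n x) (wedge_hub_v n y).
Proof.
by move: x y => [] [] //= _; rewrite ?addNr ?add0r ?eqxx ?orbT. 
Qed.

Lemma card_interlocking_wheel (m n : nat) :
  (4 <= m)%N -> (4 <= n)%N -> #|interlocking_wheel m n| = (m + n - 4)%N.
Proof.
move=> m4 n4; rewrite card_sum card_sig.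
have cardw p : (4 <= p)%N -> #|wheel p| = p.
  by case: p => [|[|[|[|p]]]] // _; rewrite card_option card_ord.
rewrite cardw // -addnBA //; congr (_ + _)%N.
have := cardC [in codom (@wedge_hub_v n)].
rewrite card_codom ?cardw //; last exact: wedge_hub_v_inj.
rewrite (_ : #|double_wedge| = 4).
  move=> /(canRL (addKn _)) <-; by apply: eq_card => y; rewrite !inE.
transitivity #|{: bool * bool}|; last by rewrite card_prod card_bool.
apply: (bij_eq_card (f := wedge_vertex_code)).
exists wedge_vertex_decode; first exact: wedge_vertex_codeK.
by case=> [] [] [].
Qed.

(* Main.v *)
(** A colouring of an overlap of G and H along K is a pair of colourings of G
    and H that agree on K. Once the colours of u, v, a, b are fixed, with hub
    colour c(u), completing the colouring of W_m amounts to choosing a walk of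
    m - 3 steps from c(b) to c(a) in the complete graph on the t - 1 colours
    other than c(u); such walks number ((t-2)^(m-3) + (-1)^m) / (t-1) when
    c(a) <> c(b) and (t-2) ((t-2)^(m-4) - (-1)^m) / (t-1) when c(a) = c(b).
    There are t (t-1) (t-2) admissible choices of c(u), c(v), c(a), c(b) with
    c(a) = c(b), and t-3 times as many with c(a) <> c(b). *)

Require Import Defs.
From mathcomp Require Import all_boot all_order all_algebra.
From mathcomp Require Import ring.
Import GRing.Theory.
Local Open Scope ring_scope.

Set Implicit Arguments.
Unset Strict Implicit.
Unset Printing Implicit Defensive.

(** Were [p - q] nonzero, the naturals below its size would be more roots than its degree allows. *)
Lemma poly_int_eq_nat (p q : {poly int}) :
  (forall k : nat, p.[k%:R] = q.[k%:R]) -> p = q.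
Proof.
move=> pq; apply/eqP; rewrite -subr_eq0; apply/negP=> /negP nz.
pose rs := [seq Posz k | k <- iota 0 (size (p - q))].
suff: (size rs < size (p - q)%R)%N by rewrite size_map size_iota ltnn.
apply: max_poly_roots => //; last by rewrite map_inj_uniq ?iota_uniq // => i j [].
by apply/allP=> _ /mapP[k _ ->]; rewrite /root hornerD hornerN -(natz k) pq subrr.
Qed.

Lemma proper_coloringP (G : sgraph) k (c : {ffun G -> 'I_k}) :
  reflect (forall x y, edge x y -> c x != c y) (proper_coloring c).
Proof.
apply: (iffP forallP) => [cP x y xy|cP x].
  by have /forallP/(_ y)/implyP := cP x; apply.
by apply/forallP=> y; apply/implyP; apply: cP.
Qed.

Definition extensions (K G : sgraph) (f : K -> G) k (h : {ffun K -> 'I_k}) :=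
  [set c : {ffun G -> 'I_k} | proper_coloring c & [ffun z => c (f z)] == h].

(** * Colourings of an overlap *)

Section OverlapColorings.
Variables (K G H : sgraph) (f : K -> G) (g : K -> H).
Hypotheses (f_inj : injective f) (g_inj : injective g).

(** The canonical map of [H] into the overlap is not a constructor: identified vertices are
    represented in [G], so it must decide membership in the image of [g]. *)
Lemma overlap_inr_sig :
  {e : H -> overlap f g | (forall z, e (g z) = inl (f z)) &
                          (forall y, e (val y) = inr y)}.
Proof.
(* Matching on [idP] keeps the proof that [iinv] and the subtype vertex require. *)
pose e y : overlap f g := match @idP (y \in codom g) with
  | ReflectT yg => inl (f (iinv yg))
  | ReflectF yNg => inr (exist _ y (introT negP yNg)) end.
exists e => [z|[y yNg]]; rewrite /e; case: {-}_ / idP => [zg|].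
- by rewrite (g_inj (f_iinv zg)).
- by case; apply: codom_f.
- by case/negP: (yNg).
- by move=> yNg' /=; congr inr; apply: val_inj.
Qed.

Lemma num_colorings_overlap k :
  num_colorings (overlap f g) k =
  (\sum_(h : {ffun K -> 'I_k}) #|extensions f h| * #|extensions g h|)%N.
Proof.
have [e eg ev] := overlap_inr_sig.
have eK y : (exists z, y = g z) \/ (exists y', y = val y' /\ e y = inr y').
  case: (boolP (y \in codom g)) => [/codomP[z ->]|yNg]; first by left; exists z.
  by right; exists (exist _ y yNg); rewrite -ev.
pose gluable := [set p : {ffun G -> 'I_k} * {ffun H -> 'I_k} |
  [&& proper_coloring p.1, proper_coloring p.2
    & [ffun z => p.1 (f z)] == [ffun z => p.2 (g z)]]].
transitivity #|gluable|; last first.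
  (* Pairs are grouped by their common restriction [h] to [K]; each class is a product of two sets
     of extensions. *)
  rewrite -sum1_card (partition_big (fun p : {ffun G -> 'I_k} * {ffun H -> 'I_k} =>
    [ffun z => p.1 (f z)] : {ffun K -> 'I_k}) xpredT) //=.
  apply: eq_bigr => h _; rewrite -cardsX sum1_card; apply: eq_card => -[c d].
  rewrite !inE /= [LHS]inE /= !inE /=.
  case: (proper_coloring c) => //=; case: (proper_coloring d) => //=.
    case: eqP => [->|cd]; first by rewrite andbb.
    by apply/esym/negP=> /andP[/eqP cE /eqP dE]; case: cd; rewrite cE dE.
  by rewrite andbF.
pose split (F : {ffun overlap f g -> 'I_k}) :=
  ([ffun x => F (inl x)], [ffun y => F (e y)]).
have split_inj : injective split.
  move=> F F' [/ffunP eqG /ffunP eqH]; apply/ffunP=> -[x|y].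
    by have := eqG x; rewrite !ffunE.
  by have := eqH (val y); rewrite !ffunE ev.
rewrite /num_colorings -(card_imset _ split_inj); apply: eq_card => -[c d].
rewrite inE /=; apply/imsetP/and3P=> [[F]|[/proper_coloringP cP /proper_coloringP dP /eqP/ffunP cd]].
  rewrite inE => /proper_coloringP FP [-> ->]; split.
  - by apply/proper_coloringP=> x x' xx'; rewrite !ffunE FP //= xx'.
  - apply/proper_coloringP=> y y'; rewrite !ffunE => yy'; apply: FP; move: yy'.
    case: (eK y) => [[z ->]|[w [-> _]]]; case: (eK y') => [[z' ->]|[w' [-> _]]];
      rewrite ?eg ?ev //= => zz'.
    (* The guard in [overlap_edge] asks for [f z != f z']: injectivity of [f] reduces it to
       [z != z'], and an edge of [H] is not a loop. *)
    + apply/orP; right; rewrite (inj_eq f_inj); apply/andP; split.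
        by apply: contraTneq zz' => ->; rewrite edge_irr.
      by apply/existsP; exists z; apply/existsP; exists z'; rewrite !eqxx.
    + by apply/existsP; exists z; rewrite eqxx.
    + by apply/existsP; exists z'; rewrite eqxx edge_sym.
  - by apply/eqP/ffunP=> z; rewrite !ffunE eg.
have {}cd z : c (f z) = d (g z) by have := cd z; rewrite !ffunE.
pose F : {ffun overlap f g -> 'I_k} :=
  [ffun p => match p with inl x => c x | inr y => d (val y) end].
exists F.
  rewrite inE; apply/proper_coloringP=> -[x|y] [x'|y'] /=; rewrite !ffunE.
  - case/orP=> [|/andP[_ /existsP[z /existsP[z']]]]; first exact: cP.
    by case/and3P=> /eqP<- /eqP<-; rewrite !cd; apply: dP.
  - by case/existsP=> z /andP[/eqP<-]; rewrite cd; apply: dP.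
  - by case/existsP=> z /andP[/eqP<-]; rewrite cd eq_sym; apply: dP.
  - exact: dP.
rewrite /split; congr pair; apply/ffunP=> y; rewrite !ffunE //.
by case: (eK y) => [[z ->]|[w [-> _]]]; rewrite ?eg ?ev ?cd.
Qed.

End OverlapColorings.

(** * Walks in a complete graph *)

Lemma sum_notin k (s : seq 'I_k) (c : int) : uniq s ->
  \sum_(w | w \notin s) c = (k%:R - (size s)%:R) * c.
Proof.
move=> /card_uniqP <-; rewrite sumr_const -[LHS]mulr_natl; congr (_ * _).
by apply/esym/(canLR (addrK _)); rewrite -natrD addnC cardC card_ord.
Qed.

Section Walks.
Variables (k : nat) (x : 'I_k).

(** Only the target is compared with [x]; the start of a walk must be kept away from [x] by
    hypothesis. *)
Definition avoiding_step : rel 'I_k := fun y z => (y != z) && (z != x).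

(* s lists the l intermediate colours of the walk from y to z. *)
Definition num_walks l (y z : 'I_k) : nat :=
  #|[set s : l.-tuple 'I_k | path avoiding_step y (rcons s z)]|.

Lemma num_walks0 y z : num_walks 0 y z = avoiding_step y z.
Proof.
rewrite /num_walks; case yz: (avoiding_step y z).
  rewrite (eq_card (B := predT)) ?card_tuple ?expn0 // => s.
  by rewrite !inE (tuple0 s) /= yz.
by apply: eq_card0 => s; rewrite !inE (tuple0 s) /= yz.
Qed.

Lemma num_walksS l y z :
  num_walks l.+1 y z = (\sum_(w | avoiding_step y w) num_walks l w z)%N.
Proof.
rewrite /num_walks -sum1_card (partition_big (@thead _ _) (avoiding_step y)) /=; last first.
  by move=> s; rewrite inE; case/tupleP: s => w s /= /andP[]; rewrite theadE.
apply: eq_bigr => w yw; rewrite -sum1_card.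
rewrite (reindex_onto (fun s : l.-tuple _ => [tuple of w :: s])
  (fun s => [tuple of behead s])) /=.
  apply: eq_bigl => s; rewrite !inE /= theadE eqxx yw /= andbT.
  by rewrite (_ : [tuple of _] = s) ?eqxx ?andbT //; apply: val_inj.
by move=> s /andP[_]; case/tupleP: s => v s; rewrite theadE => /eqP ->; apply: val_inj.
Qed.

(** Up to the factor k - 1, kept on the left to avoid division in [int], these are entries of the
    power l + 1 of the adjacency matrix of the complete graph on k - 1 vertices, with eigenvalues k
    - 2 and -1. *)
Lemma num_walksE l y z : y != x -> z != x ->
  (k%:R - 1) * (num_walks l y z)%:R =
  (if y == z then (k%:R - 2) * ((k%:R - 2) ^+ l - (-1) ^+ l)
   else (k%:R - 2) ^+ l.+1 + (-1) ^+ l) :> int.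
Proof.
move=> + zx; elim: l y => [|l IHl] y yx.
  rewrite num_walks0 /avoiding_step zx andbT; case: eqP => _ /=.
    by rewrite expr0 subrr !mulr0.
  by rewrite mulr1 expr1 expr0; ring.
rewrite num_walksS natr_sum mulr_sumr.
under eq_bigr => w /andP[_ wx] do rewrite IHl //.
set D := (k%:R - 2) ^+ l.+1 + (-1) ^+ l; set S := (k%:R - 2) * _.
have sumD : \sum_(w | avoiding_step y w) D = (k%:R - 2) * D.
  rewrite (eq_bigl (fun w => w \notin [:: x; y])) ?sum_notin //=; first by rewrite inE eq_sym yx.
  by move=> w; rewrite !inE negb_or andbC [w == y]eq_sym.
(* If the ends agree, all k - 2 first steps leave [z]; otherwise exactly one of them lands on
   [z]. *)
have [yz|yz] := eqVneq y z.
  rewrite (eq_bigr (fun=> D)); last first.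
    by move=> w /andP[yw _]; rewrite -yz eq_sym (negPf yw).
  by rewrite sumD /D [(-1) ^+ l.+1]exprS mulN1r opprK.
rewrite (bigD1 z) /=; last by rewrite /avoiding_step yz.
rewrite eqxx (eq_bigr (fun=> D)); last by move=> w /andP[_ /negPf->].
(* The sum over the colours other than [z] is [sumD] with one term removed. *)
have := sumD; rewrite (bigD1 z) /=; last by rewrite /avoiding_step yz.
move/(canRL (addKr _))->; rewrite /S /D !exprS; ring.
Qed.

End Walks.

(** * Colourings of a wheel with four prescribed colours *)

Section WheelColorings.
Variables (p k : nat).
Local Notation rim := (@rim p.+4).
Implicit Types x y a b : 'I_k.

(** With the order written [p.+4], the rim type reduces to ordinals below p + 3; only the last of
    them, -1, wraps around. *)
Lemma rim_valS (i : 'Z_(p.+3)) : (i < p.+2)%N -> (i + 1 : 'Z_(p.+3)) = i.+1 :> nat.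
Proof. by move=> ip; rewrite /= modn_small ?addn1. Qed.

Lemma rim_valN1 : (-1 : 'Z_(p.+3)) = p.+2 :> nat.
Proof. by rewrite /= modn_small. Qed.

Lemma proper_wheelP (c : {ffun wheel p.+4 -> 'I_k}) :
  reflect ((forall i, c (rim i) != c (hub _)) /\
           (forall i : 'Z_(p.+3), c (rim i) != c (rim (i + 1))))
    (proper_coloring c).
Proof.
apply: (iffP (proper_coloringP c)) => [cP|[cH cR]].
  by split=> i; apply: cP => //=; rewrite eqxx.
move=> [i|] [j|] //=; last by rewrite eq_sym cH.
  by case/orP=> /eqP->; last rewrite eq_sym; apply: cR.
by move=> _; apply: cH.
Qed.

Definition wheel_colorings x y a b := [set c : {ffun wheel p.+4 -> 'I_k} |
  proper_coloring c & [&& c (hub _) == x, c (rim 0) == y,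
                          c (rim (-1)) == a & c (rim 1) == b]].

(** [a] and [b] colour non-adjacent vertices and may coincide. *)
Definition proper_wedge x y a b :=
  [&& x != y, a \notin [:: x; y] & b \notin [:: x; y]].

(* The rim minus 0 is the path 1, 2, ..., p + 2 = -1, hence the walks from b to a. *)
Lemma card_wheel_colorings x y a b :
  #|wheel_colorings x y a b| =
  if proper_wedge x y a b then num_walks x p b a else 0%N.
Proof.
case: ifPn => [/and3P[xy]|nP]; last first.
  apply: eq_card0 => c; rewrite !inE; apply: contraNF nP.
  case/andP=> /proper_wheelP[cH cR] /and4P[/eqP<- /eqP<- /eqP<- /eqP<-].
  rewrite /proper_wedge !inE !negb_or !cH [c (hub _) == _]eq_sym cH /=.
  apply/andP; split; first by have := cR (-1); rewrite addNr.
  by have := cR 0; rewrite add0r eq_sym.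
rewrite !inE !negb_or => /andP[ax ay] /andP[bx biy].
(* Rim colours in the order 0, 1, ..., p + 2: the p + 3 entries cover the rim, so the default [x] is
   never read there. *)
pose L (s : p.-tuple 'I_k) := nth x (y :: b :: rcons s a).
pose F s : {ffun wheel p.+4 -> 'I_k} :=
  [ffun z => if z is Some i then L s (i : 'Z_(p.+3)) else x].
have F_inj : injective F.
  move=> s s' /ffunP eqF; apply: val_inj; apply: (@eq_from_nth _ x); first by rewrite !size_tuple.
  move=> i; rewrite size_tuple => ip; have ip3 : (i.+2 < p.+3)%N by rewrite !ltnS ltnW.
  have := eqF (rim (Ordinal ip3)).
  by rewrite !ffunE /L /= !nth_rcons !size_tuple ip.
rewrite /num_walks -(card_imset _ F_inj); apply: eq_card => c; rewrite inE.
have La s : L s p.+2 = a by rewrite /L /= nth_rcons size_tuple ltnn eqxx.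
apply/andP/imsetP=> [[/proper_wheelP[cH cR] /and4P[/eqP c0 /eqP cy /eqP ca /eqP cb]]|].
  (* The walk is read off the rim from vertex 2 on, since [y] and [b] occupy 0 and 1. *)
  have [s sE] : exists s : p.-tuple 'I_k,
      forall i, (i < p)%N -> nth x s i = c (rim (inord i.+2)).
    exists (mktuple (fun i : 'I_p => c (rim (inord i.+2)))) => i ip.
    by rewrite -[i in LHS]/(val (Ordinal ip)) nth_mktuple.
  have LE i : L s (i : 'Z_(p.+3)) = c (rim i).
    case: i => -[|[|i]] ip; rewrite /L /=.
    - by rewrite -cy; congr (c (rim _)); apply: val_inj.
    - by rewrite -cb; congr (c (rim _)); apply: val_inj.
    rewrite nth_rcons size_tuple; case: ltngtP => [ltip|ltpi|eqip].
    - by rewrite sE //; congr (c (rim _)); apply: val_inj; rewrite /= inordK.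
    - by have := ip; rewrite !ltnS leqNgt ltpi.
    - by rewrite -ca; congr (c (rim _)); apply: val_inj; apply: (etrans rim_valN1); rewrite /= eqip.
  exists s; last by apply/ffunP=> -[i|]; rewrite ffunE.
  rewrite inE; apply/(pathP x) => i; rewrite size_rcons size_tuple => ip.
  have ip3 : (i.+1 < p.+3)%N by rewrite ltnS ltnW.
  have := cR (Ordinal ip3); rewrite -!LE rim_valS //= => st.
  by rewrite /avoiding_step st /= -[nth _ _ _]/(L s i.+2) (LE (Ordinal (_ : i.+2 < p.+3)%N)) -c0 cH.
case=> s; rewrite inE => /(pathP x); rewrite size_rcons size_tuple => sP ->.
split; last first.
  by rewrite !ffunE -[X in X == a]/(L s (-1 : 'Z_(p.+3))) rim_valN1 La /L /= !eqxx.
have {sP} stepP i : (i < p.+1)%N -> L s i.+1 != L s i.+2 /\ L s i.+2 != x.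
  by move/sP/andP.
apply/proper_wheelP; split=> i; rewrite !ffunE.
  case: i => -[|[|i]] ip; rewrite /= ?bx //; first by rewrite /L /= eq_sym.
  by have [] := stepP i ip.
(* The closing edge from -1 to 0 is treated apart: it needs [a] to differ from [y]. *)
have := ltn_ord i; rewrite ltnS leq_eqVlt => /orP[/eqP ip|ip].
  have -> : i = (-1 : 'Z_(p.+3)) by apply: ord_inj; rewrite rim_valN1.
  by rewrite addNr -[X in X != _]/(L s (-1 : 'Z_(p.+3))) rim_valN1 La.
rewrite -[X in _ != X]/(L s ((i : 'Z_(p.+3)) + 1 : 'Z_(p.+3))) rim_valS //.
case: i ip => -[|i] ? /= ip; first by rewrite /L /= eq_sym.
by have [] := stepP i ip.
Qed.

End WheelColorings.

(** * Summation over the double wedge and the final formula *)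

(** [G] abstracts the product of walk counts, which depends on the colours only through whether
    those of [wa] and [wb] agree. *)
Lemma sum_proper_wedge k (G : bool -> int) :
  \sum_(h : {ffun double_wedge -> 'I_k} |
     proper_wedge (h wu) (h wv) (h wa) (h wb)) G (h wb == h wa) =
  k%:R * (k%:R - 1) * (k%:R - 2) * (G true + (k%:R - 3) * G false).
Proof.
pose quad := ('I_k * 'I_k * 'I_k * 'I_k)%type.
pose dec (q : quad) : {ffun double_wedge -> 'I_k} := [ffun z =>
  match z with wu => q.1.1.1 | wv => q.1.1.2 | wa => q.1.2 | wb => q.2 end].
pose enc (h : {ffun double_wedge -> 'I_k}) : quad := (h wu, h wv, h wa, h wb).
have dec_bij : bijective dec.
  exists enc => [[[[u v] a] b]|h]; first by rewrite /enc !ffunE.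
  by apply/ffunP=> -[]; rewrite !ffunE.
rewrite (reindex dec) /=; last exact: onW_bij.
transitivity (\sum_(u : 'I_k) \sum_(v | v \notin [:: u]) \sum_(a | a \notin [:: u; v])
                \sum_(b | b \notin [:: u; v]) G (b == a)).
  rewrite pair_big_dep pair_big_dep pair_big_dep /=.
  apply: eq_big => [[[[u v] a] b]|[[[u v] a] b] _]; rewrite !ffunE //=.
  by rewrite /proper_wedge !inE [v == u]eq_sym andbA.
transitivity (\sum_(u : 'I_k) \sum_(v | v \notin [:: u])
    (k%:R - 2) * (G true + (k%:R - 3) * G false)).
  apply: eq_bigr => u _; apply: eq_bigr => v vu.
  have uv_uniq : uniq [:: u; v] by rewrite /= andbT inE eq_sym -(mem_seq1 v u).
  (* The constants 2 and 3 are displayed as sizes of lists of forbidden colours, to read [sum_notin]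
     backwards. *)
  rewrite -[2]/((size [:: u; v])%:R) -sum_notin //.
  apply: eq_bigr => a auv; rewrite (bigD1 a) //= eqxx; congr (_ + _).
  rewrite -[3]/((size [:: a; u; v])%:R) -sum_notin ?[uniq _]/=; last first.
    by rewrite auv.
  apply: eq_big => [b|b /andP[_ /negPf->]] //.
  by rewrite !inE !negb_or andbC.
under eq_bigr => u _ do rewrite sum_notin //=.
by rewrite sumr_const card_ord -[LHS]mulr_natl !mulrA.
Qed.

(** The second wheel has its hub at [wv], so the roles of the first two colours are exchanged
    there. *)
Lemma proper_wedgeC k (x y a b : 'I_k) : proper_wedge y x a b = proper_wedge x y a b.
Proof. by rewrite /proper_wedge eq_sym !inE [(a == y) || _]orbC [(b == y) || _]orbC. Qed.

Lemma extensions_wedge_hub_u p k (h : {ffun double_wedge -> 'I_k}) :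
  extensions (@wedge_hub_u p.+4) h = wheel_colorings p (h wu) (h wv) (h wa) (h wb).
Proof.
apply/setP=> c; rewrite !inE; congr (_ && _).
apply/eqP/and4P=> [/ffunP eqh|[/eqP hu /eqP hv /eqP ha /eqP hb]].
  by split; rewrite -eqh ffunE.
by apply/ffunP=> -[]; rewrite ffunE.
Qed.

Lemma extensions_wedge_hub_v p k (h : {ffun double_wedge -> 'I_k}) :
  extensions (@wedge_hub_v p.+4) h = wheel_colorings p (h wv) (h wu) (h wa) (h wb).
Proof.
apply/setP=> c; rewrite !inE; congr (_ && _).
apply/eqP/and4P=> [/ffunP eqh|[/eqP hu /eqP hv /eqP ha /eqP hb]].
  by split; rewrite -eqh ffunE.
by apply/ffunP=> -[]; rewrite ffunE.
Qed.

(* The common factor k - 1 may vanish, so it is cancelled only once the identity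
   has been lifted to polynomials. *)
Lemma num_colorings_interlocking_wheel p q k :
  (k%:R - 1) ^+ 2 * (num_colorings (interlocking_wheel p.+4 q.+4) k)%:R =
  k%:R * (k%:R - 1) * (k%:R - 2) *
    ((k%:R - 2) ^+ 2 * ((k%:R - 2) ^+ p - (-1) ^+ p) * ((k%:R - 2) ^+ q - (-1) ^+ q)
     + (k%:R - 3) * ((k%:R - 2) ^+ p.+1 + (-1) ^+ p)
                  * ((k%:R - 2) ^+ q.+1 + (-1) ^+ q)) :> int.
Proof.
pose walks (l : nat) (e : bool) : int :=
  if e then (k%:R - 2) * ((k%:R - 2) ^+ l - (-1) ^+ l)
  else (k%:R - 2) ^+ l.+1 + (-1) ^+ l.
transitivity (\sum_(h : {ffun double_wedge -> 'I_k} |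
     proper_wedge (h wu) (h wv) (h wa) (h wb))
       walks p (h wb == h wa) * walks q (h wb == h wa)); last first.
  by rewrite (sum_proper_wedge k (fun e => walks p e * walks q e)) /walks; ring.
rewrite num_colorings_overlap; [|exact: wedge_hub_u_inj|exact: wedge_hub_v_inj].
rewrite natr_sum mulr_sumr [RHS]big_mkcond; apply: eq_bigr => h _.
rewrite extensions_wedge_hub_u extensions_wedge_hub_v !card_wheel_colorings.
rewrite [proper_wedge (h wv) _ _ _]proper_wedgeC; case: ifP => [|_]; last first.
  by rewrite mulr0.
case/and3P=> _; rewrite !inE !negb_or => /andP[au av] /andP[bu bv].
(* Each wheel takes one of the two factors k - 1. *)
by rewrite natrM expr2 mulrACA !num_walksE.
Qed.

Theorem mainTheorem1 (m n : nat) (hm : (4 <= m)%N) (hn : (4 <= n)%N)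
    (hmn : (9 <= m + n)%N) :
  let t : {fraction {poly int}} := tofrac 'X in
  tofrac (chromatic_poly (interlocking_wheel m n)) =
    1 / (t - 1) *
      (t * (t - 2) * (t - 3)
         * ((t - 2) ^+ (n - 3) + (-1) ^+ n)
         * ((t - 2) ^+ (m - 3) + (-1) ^+ m)
       + t * (t - 2) ^+ 3
         * ((t - 2) ^+ (n - 4) + (-1) ^+ (n - 1))
         * ((t - 2) ^+ (m - 4) + (-1) ^+ (m - 1))).
Proof.
case: m n hm hn {hmn} => [|[|[|[|p]]]] // [|[|[|[|q]]]] // _ _ t.
rewrite !subSS !subn0.
have X1_neq0 : 'X - 1 != 0 :> {poly int} by rewrite -polyC1 polyXsubC_eq0.
have t1_neq0 : t - 1 != 0 by rewrite -tofrac1 -tofracB tofrac_eq0.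
rewrite div1r; apply: (canRL (mulKf t1_neq0)).
(* The bracket of the formula with m = p + 4 and n = q + 4, its signs reduced to powers p and q of
   -1. *)
pose P : {poly int} := 'X * ('X - 2) * ('X - 3)
    * (('X - 2) ^+ q.+1 + (-1) ^+ q) * (('X - 2) ^+ p.+1 + (-1) ^+ p)
  + 'X * ('X - 2) ^+ 3
    * (('X - 2) ^+ q - (-1) ^+ q) * (('X - 2) ^+ p - (-1) ^+ p).
have chiE : ('X - 1) * chromatic_poly (interlocking_wheel p.+4 q.+4) = P.
  (* A second factor ['X - 1] is inserted to match the square in the count at [k]. *)
  apply: (mulfI X1_neq0); apply: poly_int_eq_nat => k.
  rewrite mulrA -expr2 !(hornerMn, horner_exp, hornerM, hornerD, hornerN, hornerX, hornerC) chromatic_polyE.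
  rewrite num_colorings_interlocking_wheel; ring.
have := congr1 (@tofrac _) chiE.
rewrite /P !(tofracM, tofracD, tofracN, tofracXn, tofracMn, tofrac1) -/t => ->.
by rewrite !exprS; ring.
Qed.
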